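(* For $m,b\in\mathbf{Q}$ with $m\neq 0$, let $L_{m,b}=\{(x,y)\in\mathbf{R}^2 : y=mx+b\}$. Consider the following two subsets of $\mathbf{R}^2$, with the subspace topology: $$B=\bigcup_{m,b\in\mathbf{Q},\ m\neq 0}L_{m,b}\quad\text{and}\quad A=\mathbf{R}^2\setminus B.$$ Then: (1) $B$ is dense in $\mathbf{R}^2$, locally connected and, hence, rr-good. (2) $A$ is dense in $\mathbf{R}^2$ and has a basis of clopen sets. It is not rr-good.
   Context: For a Tychonoff space $X$, $\mathrm{C}(X)$ is the ring of continuous real-valued functions on $X$. It is partially ordered by the reduced ring order: $f\le_{\mathrm{rr}} g$ if and only if $f^2=fg$. The space $X$ is called rr-good if every pair $f,g\in \mathrm{C}(X)$ has an infimum (greatest lower bound) in the partial order $\le_{\mathrm{rr}}$. *)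

(* Defs.v *)
From HB Require Import structures.
From mathcomp Require Import all_boot all_order all_algebra.
From mathcomp Require Import all_classical all_reals all_analysis.

Set Implicit Arguments.
Unset Strict Implicit.
Unset Printing Implicit Defensive.
Import Order.TTheory GRing.Theory Num.Theory.
Import numFieldNormedType.Exports.

Local Open Scope classical_set_scope.
Local Open Scope ring_scope.

(* The reduced ring order. *)
Definition rr_le {A : pzRingType} (a b : A) : Prop := a ^+ 2 = a * b.

Definition is_glb {T : Type} (le : T -> T -> Prop) (a b c : T) : Prop :=
  [/\ le c a, le c b & forall d, le d a -> le d b -> le d c].

(* C(X) is [continuousType X R]; its ring operations are the pointwise ones,
   inherited from the ring of all functions X -> R. *)
Definition C_rr_le {R : realType} {X : topologicalType}
    (f g : continuousType X R) : Prop :=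
  rr_le (f : X -> R) (g : X -> R).

(* The Tychonoff property is not required here: it holds for every subspace
   of the plane. *)
Definition rr_good (R : realType) (X : topologicalType) : Prop :=
  forall f g : continuousType X R, exists h, is_glb C_rr_le f g h.

(* The members of a [basis] are open by definition. *)
Definition locally_connected (X : topologicalType) : Prop :=
  exists2 U : set (set X), basis U & U `<=` connected.

Definition has_clopen_basis (X : topologicalType) : Prop :=
  exists2 U : set (set X), basis U & U `<=` clopen.

Definition rat_line (R : realType) (m b : rat) : set (R * R) :=
  [set p | p.2 = ratr m * p.1 + ratr b].
Arguments rat_line : clear implicits.

(* Coerced to a type, a set carries the subspace topology
   (the initial topology of the inclusion). *)
Definition set_B (R : realType) : set (R * R) :=
  \bigcup_(mb in [set mb : rat * rat | mb.1 != 0]) rat_line R mb.1 mb.2.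
Arguments set_B : clear implicits.

Definition set_A (R : realType) : set (R * R) := ~` set_B R.
Arguments set_A : clear implicits.

(* Main.v *)
Require Import Defs.
From HB Require Import structures.
From mathcomp Require Import all_boot all_order all_algebra.
From mathcomp Require Import all_classical all_reals all_analysis.
From mathcomp Require Import borel_hierarchy.
From mathcomp Require Import ring lra.
Import Order.TTheory GRing.Theory Num.Theory.
Import numFieldNormedType.Exports.
Local Open Scope classical_set_scope.
Local Open Scope ring_scope.

(** In the reduced ring order, [d <= f] means that at every point [d] is either
    0 or equal to [f].  The cozero set of such a [d] is therefore open, and
    closed relatively to the cozero set of [f].

    Locally connected spaces are rr-good ([locally_connected_rr_good]): given
    [f] and [g], let [W] be the union of the cozero sets of all their common
    lower bounds.  A connected subset of the cozero set of [f] that meets one of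
    these relatively clopen sets lies inside it, so local connectedness makes
    [W] relatively clopen in the cozero set of [f] as well.  The function that
    equals [f] on [W] and 0 elsewhere is then continuous (at a zero of [f] it is
    dominated by [f]), and it is the infimum.

    The space [B] is locally connected because [B] meets every convex open set
    [U] in a connected set ([connected_B_convex]).  A point of [B] on a line [L]
    can be moved along [L], inside [U], to a rational point; two rational points
    that differ in both coordinates span a line of [B], whose segment between
    them stays in the convex set [U].

    The space [A] has a clopen basis because the functions [x + y] and [y - x]
    take no rational value on it (the lines of slope -1 and 1 with rational
    intercept lie in [B]): a diamond cut out by rational bounds on these two
    functions traces the same set on [A] as the closed diamond.

    In an rr-good space with a clopen basis the interior of every zero set is
    closed ([rr_good_closed_interior_zero]): the infimum of 1 and [1 + g] is the
    indicator function of the largest clopen set contained in the zero set of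
    [g].  This fails in [A]: for a point [p] of [A], the density of [A] makes
    [p] a limit of the interior of the half-plane to its right without being
    interior to it. *)

(** * The reduced ring order on continuous functions *)

Lemma C_rr_leP {R : realType} {X : topologicalType} (f g : continuousType X R) :
  C_rr_le f g <-> forall x, f x = 0 \/ f x = g x.
Proof.
split=> [fg x|fg].
  have : (f x) ^+ 2 = f x * g x by exact: (congr1 (@^~ x) fg).
  move/eqP; rewrite expr2 -subr_eq0 -mulrBr mulf_eq0 subr_eq0.
  by case/orP=> /eqP ->; [left|right].
apply/funext => x; rewrite /rr_le !fctE expr2.
by case: (fg x) => ->; rewrite ?mul0r.
Qed.

Definition cozero {R : realType} {X : Type} (f : X -> R) : set X :=
  [set x | f x != 0].

Lemma open_cozero {R : realType} {X : topologicalType} (f : X -> R) :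
  continuous f -> open (cozero f).
Proof.
move=> cf; apply: (@open_comp _ _ f [set r | r != 0]); last exact: open_neq.
by move=> x _; exact: cf.
Qed.

(** Every lower bound of [f] has this form, with [W] its cozero set. *)
Definition cut {R : realType} {X : Type} (W : set X) (f : X -> R) : X -> R :=
  fun x => if x \in W then f x else 0.

Lemma cut_in {R : realType} {X : Type} (W : set X) (f : X -> R) x :
  W x -> cut W f x = f x.
Proof. by move=> Wx; rewrite /cut mem_set. Qed.

Lemma cut_out {R : realType} {X : Type} (W : set X) (f : X -> R) x :
  ~ W x -> cut W f x = 0.
Proof. by move=> Wx; rewrite /cut memNset. Qed.

(** Away from the zeros of [f] the two openness hypotheses make [cut W f]
    locally equal to [f] or to 0; at a zero of [f] it is continuous because its
    absolute value is at most that of [f]. *)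
Lemma continuous_cut {R : realType} {X : topologicalType} (W : set X)
    (f : X -> R) :
    continuous f -> open (W `&` cozero f) -> open (cozero f `\` W) ->
  continuous (cut W f).
Proof.
move=> cf oW oW' x; rewrite /continuous_at; have [fx0|fx] := eqVneq (f x) 0.
  have -> : cut W f x = 0 by rewrite /cut fx0 if_same.
  apply/cvgrPdist_le => e e0.
  have := cf x; rewrite /continuous_at fx0 => /cvgrPdist_le /(_ e e0).
  apply: filterS => y; rewrite !sub0r !normrN /cut.
  by case: ifP => // _ _; rewrite normr0 ltW.
have [Wx|Wx] := pselect (W x).
  rewrite cut_in//; apply: cvg_trans (cf x); apply: near_eq_cvg.
  have : nbhs x (W `&` cozero f) by apply: open_nbhs_nbhs; split.
  by apply: filterS => y [Wy _]; rewrite cut_in.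
rewrite cut_out//; apply: cvg_near_cst.
have : nbhs x (cozero f `\` W) by apply: open_nbhs_nbhs; split.
by apply: filterS => y [_ Wy]; rewrite cut_out.
Qed.

(** This exhibits the cozero set of [d] as relatively closed in that of [f]: its
    relative complement is the trace of an open set. *)
Lemma cozero_setD_lower_bound {R : realType} {X : topologicalType}
    (f d : continuousType X R) :
  C_rr_le d f ->
  cozero f `\` cozero d = cozero f `&` cozero (fun x => f x - d x).
Proof.
move=> /C_rr_leP df; apply/seteqP; split=> x [fx]; rewrite /cozero /= subr_eq0.
  by move=> /negP/negPn/eqP ->.
by move=> fdx; split=> // dx; case: (df x) => dfx;
  [rewrite dfx eqxx in dx|rewrite dfx eqxx in fdx].
Qed.

(** * Locally connected spaces are rr-good *)

Lemma connected_sub_clopen {X : topologicalType} (N V : set X) :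
    connected N -> N `&` V !=set0 -> open V ->
    (exists2 F, open F & N `\` V = N `&` F) -> N `<=` V.
Proof.
move=> cN NV oV [F oF NVF].
suff <- : N `&` V = N by exact: subIsetr.
apply: cN => //; first by exists V.
exists (~` F); first exact: open_closedC.
rewrite -setDE; apply/seteqP; split=> x [Nx] => [Vx|nFx].
  split=> // Fx; have : (N `&` F) x by [].
  by rewrite -NVF => -[].
split=> //; apply: contrapT => nVx; apply: nFx.
by have : (N `\` V) x by []; rewrite NVF => -[].
Qed.

Lemma locally_connected_rr_good (R : realType) (X : topologicalType) :
  locally_connected X -> rr_good R X.
Proof.
move=> [U [oU bU] cU] f g.
pose low (d : continuousType X R) := C_rr_le d f /\ C_rr_le d g.
pose W := \bigcup_(d in low) cozero d.
have WE x : W x -> f x = g x.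
  move=> [d [/C_rr_leP df /C_rr_leP dg]]; rewrite /cozero /= => dx.
  case: (df x) => [d0|dfx]; first by rewrite d0 eqxx in dx.
  case: (dg x) => [d0|dgx]; first by rewrite d0 eqxx in dx.
  by rewrite -dgx -dfx.
have oW : open W.
  by apply: bigcup_open => d _; apply: open_cozero; exact: cts_fun.
have cf : continuous f by exact: cts_fun.
(* A union of relatively clopen sets need not be relatively closed; this is
   where local connectedness enters. *)
have oWD : open (cozero f `\` W).
  rewrite openE => x [fx Wx].
  have /bU[N [UN Nx] Nf] : nbhs x (cozero f).
    by apply: open_nbhs_nbhs; split=> //; exact: open_cozero.
  have : nbhs x N by apply: open_nbhs_nbhs; split=> //; exact: oU.
  apply: filterS => y Ny; split; first exact: Nf.
  move=> [d ld dy]; apply: Wx; exists d => //.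
  apply: (@connected_sub_clopen _ N) => //; first exact: cU.
  - by exists y.
  - by apply: open_cozero; exact: cts_fun.
  - exists (cozero (fun x => f x - d x)).
      apply: open_cozero => z; apply: cvgB; first exact: cf.
      exact: cts_fun.
    have := cozero_setD_lower_bound f d (proj1 ld).
    by move=> /(congr1 (setI N)); rewrite setIDA setIA (setIidl Nf).
have ch : continuous (cut W f).
  by apply: continuous_cut => //; apply: openI => //; exact: open_cozero.
pose h : continuousType X R := mkcts ch.
have hE x : h x = cut W f x by [].
exists h; split.
- apply/C_rr_leP => x; rewrite hE; have [Wx|Wx] := pselect (W x).
    by right; rewrite cut_in.
  by left; rewrite cut_out.
- apply/C_rr_leP => x; rewrite hE; have [Wx|Wx] := pselect (W x).
    by right; rewrite cut_in//; exact: WE.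
  by left; rewrite cut_out.
- move=> d df dg; apply/C_rr_leP => x; rewrite hE.
  have [->|dx] := eqVneq (d x) 0; [by left|right].
  have Wx : W x by exists d.
  rewrite cut_in//; move/C_rr_leP: df => /(_ x) [d0|//].
  by rewrite d0 eqxx in dx.
Qed.

(** * Rr-good spaces with a clopen basis *)

(** A lower bound of 1 takes only the values 0 and 1, and a lower bound of
    [1 + g] that takes the value 1 does so only where [g] vanishes.  So the
    infimum [h] of 1 and [1 + g] is the indicator function of a clopen set
    contained in the zero set of [g].  Conversely, the indicator function of any
    basic clopen set inside that zero set lies below [h].  Hence the interior of
    the zero set is [{h = 1}]. *)
Lemma rr_good_closed_interior_zero (R : realType) (X : topologicalType)
    (g : X -> R) :
    has_clopen_basis X -> rr_good R X -> continuous g ->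
  closed (interior [set x | g x = 0]).
Proof.
move=> [U [oU bU] cU] good cg.
have c1 : continuous (fun _ : X => 1 : R) by move=> x; exact: cvg_cst.
pose one : continuousType X R := mkcts c1.
have cg1 : continuous (fun x => 1 + g x).
  by move=> x; apply: cvgD; [exact: cvg_cst|exact: cg].
pose g1 : continuousType X R := mkcts cg1.
have [h [/C_rr_leP/= h1 /C_rr_leP/= hg hmax]] := good one g1.
have ch : continuous h by exact: cts_fun.
suff -> : interior [set x | g x = 0] = ~` cozero (fun x => 1 - h x).
  apply: open_closedC; apply: open_cozero => x.
  by apply: cvgB; [exact: cvg_cst|exact: ch].
apply/seteqP; split=> x; rewrite /cozero /=.
- move=> /bU[D [UD Dx] D0]; apply/negP; rewrite negbK subr_eq0.
  have [oD cD] := cU _ UD.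
  have ce : continuous (cut D (fun=> 1 : R)).
    have coz1 : cozero (fun=> 1 : R) = [set: X].
      by apply/seteqP; split=> // y _; rewrite /cozero /= oner_eq0.
    apply: continuous_cut; first by move=> ?; exact: cvg_cst.
      by rewrite coz1 setIT.
    by rewrite coz1 setTD; exact: closed_openC.
  pose e : continuousType X R := mkcts ce.
  have eE y : e y = cut D (fun=> 1 : R) y by [].
  have /C_rr_leP/(_ x) : C_rr_le e h.
    apply: hmax; apply/C_rr_leP => y; rewrite eE.
      have [Dy|Dy] := pselect (D y); [right|left]; last by rewrite cut_out.
      by rewrite cut_in.
    have [Dy|Dy] := pselect (D y); [right|left]; last by rewrite cut_out.
    have -> : g1 y = 1 + g y by [].
    by rewrite cut_in// (D0 y Dy) addr0.
  by rewrite eE cut_in// => -[/eqP|<-//]; rewrite oner_eq0.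
- move=> /negP; rewrite negbK subr_eq0 => /eqP hx.
  have : nbhs x (cozero h).
    by apply: open_nbhs_nbhs; split; [exact: open_cozero|
      rewrite /cozero /= -hx oner_eq0].
  apply: filterS => y; rewrite /cozero /= => hy.
  case: (h1 y) => [h0|h1y]; first by rewrite h0 eqxx in hy.
  case: (hg y) => [h0|]; first by rewrite h0 eqxx in hy.
  by rewrite h1y => /esym/eqP; rewrite -subr_eq0 addrC addKr => /eqP.
Qed.

(** * Subspaces, rational numbers and segments *)

Lemma basis_subspace {T : topologicalType} (A : set T) (U : set (set T)) :
  basis U -> @basis A [set (@set_val T A) @^-1` V | V in U].
Proof.
move=> [oU bU]; split=> [_ [V UV <-]|x P].
  by apply: open_comp (oU V UV) => y _; exact: initial_continuous.
rewrite nbhsE => -[_ [ [W oW <-] Wx] WP].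
have /bU[V [UV Vx] VW] : nbhs (set_val x) W by exact: open_nbhs_nbhs.
exists (set_val @^-1` V); first by split=> //; exists V.
by move=> y Vy; apply: WP; exact: VW.
Qed.

(** A relatively clopen part of the trace of [C] comes from an open set and a
    closed set of the ambient space, so the connectedness of [C] there applies
    to it. *)
Lemma connected_subspace {T : topologicalType} (A C : set T) :
  C `<=` A -> connected C -> connected ((@set_val T A) @^-1` C).
Proof.
move=> CA cC D [d Dd] [_ [V oV <-] DV] [F cF DF].
have [W oW WF] : open (~` F) by exact: closed_openC.
have CV : C `&` V = C.
  apply: cC; first by exists (set_val d); move: Dd; rewrite DV.
    by exists V.
  exists (~` W); first exact: open_closedC.
  have memD x (Cx : C x) : V x <-> ~ W x.
    pose y : A := SigSub (mem_set (CA x Cx)).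
    have -> : V x = D y by rewrite DV; apply/propext; split=> [|[]//]; split.
    have -> : W x = (~` F) y by rewrite -WF.
    by rewrite DF; split=> [[_ Fy] nFy //|/contrapT Fy]; split.
  by apply/seteqP; split=> x [Cx] /(memD x Cx); split.
rewrite DV; apply/seteqP; split=> [x []//|x Cx]; split=> //.
by have : C (set_val x) := Cx; rewrite -CV => -[].
Qed.

Lemma dense_irrational (R : realType) : dense (@irrational R).
Proof.
have [F odF ->] := @irrational_Gdelta R.
exact: (@Baire R R^o).
Qed.

(** Among three distinct rationals in the interval one differs from both [u] and
    [v]. *)
Lemma rat_between_avoiding {R : realType} (a b u v : R) : a < b ->
  exists q : rat, [/\ a < ratr q, ratr q < b, ratr q != u & ratr q != v].
Proof.
move=> ab.
have [q1] := rat_in_itvoo ab; rewrite in_itv/= => /andP[aq1 q1b].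
have [q2] := rat_in_itvoo q1b; rewrite in_itv/= => /andP[q12 q2b].
have [q3] := rat_in_itvoo q2b; rewrite in_itv/= => /andP[q23 q3b].
have [u1|u1] := eqVneq (ratr q1) u; have [v1|v1] := eqVneq (ratr q1) v;
  have [u2|u2] := eqVneq (ratr q2) u; have [v2|v2] := eqVneq (ratr q2) v;
  do [by exists q1; split; rewrite //; lra
  |by exists q2; split; rewrite //; lra
  |by exists q3; split; rewrite ?gt_eqF//; lra].
Qed.

Definition segment {R : realType} (p q : R * R) : set (R * R) :=
  [set (p.1 + t * (q.1 - p.1), p.2 + t * (q.2 - p.2)) | t in `[0, 1]].

Lemma segment_l {R : realType} (p q : R * R) : segment p q p.
Proof.
exists 0; first by rewrite /= in_itv/= lexx ler01.
by rewrite !mul0r !addr0 -surjective_pairing.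
Qed.

Lemma segment_r {R : realType} (p q : R * R) : segment p q q.
Proof.
exists 1; first by rewrite /= in_itv/= lexx ler01.
by rewrite !mul1r !subrKC -surjective_pairing.
Qed.

Lemma connected_segment {R : realType} (p q : R * R) : connected (segment p q).
Proof.
apply: connected_continuous_connected; first exact: segment_connected.
have affine_continuous (a b : R) : continuous (fun t : R => a + t * b).
  by move=> t; apply: cvgD; [exact: cvg_cst|apply: cvgMr_tmp; exact: cvg_id].
apply: continuous_subspaceT => t.
exact: (cvg_pair (affine_continuous _ _ t) (affine_continuous _ _ t)).
Qed.

Lemma convex_segment {R : realType} (U : set (convex_lmodType (R * R)%type))
    (p q : R * R) :
  convex_set U -> U p -> U q -> segment p q `<=` U.
Proof.
move=> cU Up Uq x [t /=]; rewrite in_itv/= => /andP[t0 t1] <-{x}.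
have := cU q p (Itv01 t0 t1) (mem_set Uq) (mem_set Up).
rewrite inE; congr (U _).
have convE (a b : R) : t * b + (1 - t) * a = a + t * (b - a) by ring.
exact: (congr2 pair (convE _ _) (convE _ _)).
Qed.

Lemma segment_rat_line {R : realType} (m b : rat) (p q : R * R) :
  rat_line R m b p -> rat_line R m b q -> segment p q `<=` rat_line R m b.
Proof.
by rewrite /rat_line /= => pE qE _ [t _ <-] /=; rewrite pE qE; ring.
Qed.

Lemma rat_line_subset_B (R : realType) (m b : rat) :
  m != 0 -> rat_line R m b `<=` set_B R.
Proof. by move=> m0 p Lp; exists (m, b). Qed.

Lemma rat_line_through (R : realType) (x y x' y' : rat) :
  x != x' -> y != y' -> exists2 mb : rat * rat, mb.1 != 0 &
    rat_line R mb.1 mb.2 (ratr x, ratr y) /\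
    rat_line R mb.1 mb.2 (ratr x', ratr y').
Proof.
move=> xx' yy'; pose m := (y' - y) / (x' - x).
exists (m, y - m * x) => /=.
  by rewrite mulf_neq0 ?invr_eq0 // subr_eq0 eq_sym.
rewrite /rat_line /= -!rmorphM -!rmorphD /=; split; congr ratr; rewrite /m.
  by ring.
by field; rewrite subr_eq0 eq_sym.
Qed.

(** * Density of both sets *)

Lemma nbhs_box {R : realType} (p : R * R) (U : set (R * R)) :
  nbhs p U -> exists2 e : R, 0 < e &
    forall x y, `|p.1 - x| < e -> `|p.2 - y| < e -> U (x, y).
Proof.
move=> /nbhs_ballP[e /= e0 peU]; exists e => // x y px py.
by apply: peU; split; rewrite -ball_normE.
Qed.

Lemma dense_B (R : realType) : dense (set_B R).
Proof.
move=> O [p Op] oO.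
have [e e0 boxO] := nbhs_box p O (open_nbhs_nbhs (conj oO Op)).
have pe (a : R) : a < a + e by rewrite ltrDl.
have [x] := rat_in_itvoo (pe p.1); rewrite in_itv/= => /andP[px xe].
have [y] := rat_in_itvoo (pe p.2); rewrite in_itv/= => /andP[py ye].
exists (ratr x, ratr y); split.
  by apply: boxO; rewrite distrC ltr_norml; lra.
exists (1, y - x); first by [].
by rewrite /rat_line /= rmorph1 mul1r rmorphB /= addrC subrK.
Qed.

(** A point with a rational abscissa and an irrational ordinate is on none of
    the lines, since [m * x + b] is rational when [x] is. *)
Lemma dense_A (R : realType) : dense (set_A R).
Proof.
move=> O [p Op] oO.
have [e e0 boxO] := nbhs_box p O (open_nbhs_nbhs (conj oO Op)).
have pe (a : R) : a < a + e by rewrite ltrDl.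
have [x] := rat_in_itvoo (pe p.1); rewrite in_itv/= => /andP[px xe].
have [y [yp yirr]] : `]p.2, p.2 + e[ `&` @irrational R !=set0.
  apply: dense_irrational; last exact: interval_open.
  by exists (p.2 + e / 2); rewrite /= in_itv/=; apply/andP; split; lra.
move: yp; rewrite /= in_itv/= => /andP[py ye].
exists (ratr x, y); split.
  by apply: boxO; rewrite distrC ltr_norml; lra.
move=> [[m b] _]; rewrite /rat_line /= => yE; apply: yirr.
by exists (m * x + b) => //; rewrite yE rmorphD rmorphM.
Qed.

(** * Local connectedness of the union of the lines *)

(** All points of [B] in [U] are joined to one rational point [r0] of [U] by two
    segments: one along the line of the given point, up to a rational point
    [r] that differs from [r0] in both coordinates, and one from [r] to [r0].
    The lines are not horizontal, so such an [r] exists arbitrarily close to the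
    given point. *)
Lemma connected_B_convex (R : realType) (U : set (R * R)) :
  open U -> convex_set (U : set (convex_lmodType (R * R)%type)) ->
  connected (set_B R `&` U).
Proof.
move=> oU cU.
have near_rat (p : R * R) (u v : R) : (set_B R `&` U) p -> exists x y : rat,
    [/\ ratr x != u, ratr y != v &
        connected_component (set_B R `&` U) p (ratr x, ratr y)].
  move=> [[[m b] /= m0 Lp] Up].
  have rm0 : (ratr m : R) != 0 by rewrite fmorph_eq0.
  have [e e0 boxU] := nbhs_box p U (open_nbhs_nbhs (conj oU Up)).
  (* On a line of slope [m] the ordinate moves [`|m|] times as fast as the
     abscissa: this radius keeps both coordinates within [e]. *)
  have k0 : 0 < 1 + `|ratr m : R| by rewrite ltr_pwDl.
  have d0 : 0 < e / (1 + `|ratr m|) by rewrite divr_gt0.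
  have pd : p.1 < p.1 + e / (1 + `|ratr m|) by rewrite ltrDl.
  have [x [px xd xu xv]] :=
    rat_between_avoiding _ _ u ((v - ratr b) / ratr m) pd.
  exists x, (m * x + b); split=> //.
    apply: contra_neq xv => <-.
    by rewrite rmorphD rmorphM /= addrK mulrAC divff// mul1r.
  pose q : R * R := (ratr x, ratr (m * x + b)).
  have Lq : rat_line R m b q by rewrite /rat_line /= rmorphD rmorphM.
  have Uq : U q.
    have pxd : `|p.1 - ratr x| < e / (1 + `|ratr m|).
      by rewrite distrC [X in X < _]gtr0_norm ?subr_gt0// ltrBlDl.
    apply: boxU.
      apply: lt_le_trans pxd _; rewrite ler_pdivrMr// ler_peMr ?(ltW e0)//.
      by rewrite lerDl.
    rewrite [p.2]Lp rmorphD rmorphM /= opprD addrACA subrr addr0 -mulrBr normrM.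
    apply: (@le_lt_trans _ _ ((1 + `|ratr m|) * `|p.1 - ratr x|)).
      by rewrite ler_wpM2r// lerDr.
    by rewrite mulrC -ltr_pdivlMr.
  apply: (@connected_component_max _ _ (segment p q)).
  - exact: segment_l.
  - move=> z pqz; split; last exact: convex_segment cU Up Uq _ pqz.
    exact/(rat_line_subset_B _ _ _ m0)/(segment_rat_line m b p q).
  - exact: connected_segment.
  - exact: segment_r.
have [[p0 Bp0]|B0] := pselect ((set_B R `&` U) !=set0); last first.
  by move/set0P/negP/negPn/eqP: B0 => ->; exact: connected0.
have [x0 [y0 [_ _ /connected_component_sub[_ Ur0]]]] := near_rat p0 0 0 Bp0.
pose r0 : R * R := (ratr x0, ratr y0).
suff -> : set_B R `&` U = connected_component (set_B R `&` U) r0.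
  exact: component_connected.
apply/seteqP; split; last exact: connected_component_sub.
move=> p Bp; have [x [y [xx0 yy0 pr]]] := near_rat p (ratr x0) (ratr y0) Bp.
have [_ Ur] := connected_component_sub pr.
have [mb m0 [Lr0 Lr]] : exists2 mb : rat * rat, mb.1 != 0 &
    rat_line R mb.1 mb.2 r0 /\ rat_line R mb.1 mb.2 (ratr x, ratr y).
  apply: rat_line_through; [move: xx0|move: yy0]; apply: contra_neq.
    by move=> ->.
  by move=> ->.
apply: connected_component_trans (connected_component_sym pr).
apply: (@connected_component_max _ _ (segment r0 (ratr x, ratr y))).
- exact: segment_l.
- move=> z rz; split; last exact: convex_segment cU Ur0 Ur _ rz.
  exact/(rat_line_subset_B _ _ _ m0)/(segment_rat_line _ _ _ _ Lr0 Lr).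
- exact: connected_segment.
- exact: segment_r.
Qed.

Lemma locally_connected_B (R : realType) : locally_connected (set_B R).
Proof.
have [U cU bU] := @locally_convex R (R * R)%type.
exists [set (@set_val _ (set_B R)) @^-1` V | V in U].
  exact: basis_subspace.
move=> _ [V UV <-].
have -> : (@set_val _ (set_B R)) @^-1` V = set_val @^-1` (set_B R `&` V).
  apply/seteqP; split=> x /=; last by case.
  by move=> Vx; split=> //; exact: set_valP.
apply: connected_subspace; first exact: subIsetl.
apply: connected_B_convex; first exact: bU.1.
by apply: cU; exact: mem_set.
Qed.

(** * A clopen basis of the complement *)

Definition diamond (R : realType) (a b c d : rat) : set (R * R) :=
  (fun p => p.1 + p.2) @^-1` `]ratr a, ratr b[ `&`
  (fun p => p.2 - p.1) @^-1` `]ratr c, ratr d[.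

Definition closed_diamond (R : realType) (a b c d : rat) : set (R * R) :=
  (fun p => p.1 + p.2) @^-1` `[ratr a, ratr b] `&`
  (fun p => p.2 - p.1) @^-1` `[ratr c, ratr d].

Lemma continuous_sum_coord (R : realType) :
  continuous (fun p : R * R => p.1 + p.2).
Proof. by move=> p; apply: cvgD; [exact: cvg_fst|exact: cvg_snd]. Qed.

Lemma continuous_diff_coord (R : realType) :
  continuous (fun p : R * R => p.2 - p.1).
Proof. by move=> p; apply: cvgB; [exact: cvg_snd|exact: cvg_fst]. Qed.

Lemma open_diamond (R : realType) (a b c d : rat) : open (diamond R a b c d).
Proof.
apply: openI.
  apply: open_comp; last exact: interval_open.
  by move=> p _; exact: continuous_sum_coord.
apply: open_comp; last exact: interval_open.
by move=> p _; exact: continuous_diff_coord.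
Qed.

Lemma closed_closed_diamond (R : realType) (a b c d : rat) :
  closed (closed_diamond R a b c d).
Proof.
apply: closedI.
  apply: closed_comp; last exact: interval_closed.
  by move=> p _; exact: continuous_sum_coord.
apply: closed_comp; last exact: interval_closed.
by move=> p _; exact: continuous_diff_coord.
Qed.

Lemma basis_diamond (R : realType) :
  basis [set diamond R q.1.1 q.1.2 q.2.1 q.2.2
        | q in [set: (rat * rat) * (rat * rat)]].
Proof.
split=> [_ [q _ <-]|p U]; first exact: open_diamond.
move=> /nbhs_box[e e0 boxU].
have e_lt (r : R) : r - e < r by rewrite ltrBlDr ltrDl.
have e_gt (r : R) : r < r + e by rewrite ltrDl.
have [a] := rat_in_itvoo (e_lt (p.1 + p.2)); rewrite in_itv/= => /andP[a1 a2].
have [b] := rat_in_itvoo (e_gt (p.1 + p.2)); rewrite in_itv/= => /andP[b1 b2].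
have [c] := rat_in_itvoo (e_lt (p.2 - p.1)); rewrite in_itv/= => /andP[c1 c2].
have [d] := rat_in_itvoo (e_gt (p.2 - p.1)); rewrite in_itv/= => /andP[d1 d2].
exists (diamond R a b c d).
  split; first by exists ((a, b), (c, d)).
  by rewrite /diamond /= !in_itv/= a2 b1 c2 d1.
move=> [x y]; rewrite /diamond /= !in_itv/=.
move=> -[/andP[xy1 xy2] /andP[yx1 yx2]].
by apply: boxU; rewrite ltr_norml; lra.
Qed.

Lemma A_sum_neq_rat (R : realType) (p : R * R) (q : rat) :
  set_A R p -> p.1 + p.2 != ratr q.
Proof.
move=> Ap; apply/eqP => pq; apply: Ap; exists (- 1, q); first by [].
by rewrite /rat_line /= rmorphN rmorph1; lra.
Qed.

Lemma A_diff_neq_rat (R : realType) (p : R * R) (q : rat) :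
  set_A R p -> p.2 - p.1 != ratr q.
Proof.
move=> Ap; apply/eqP => pq; apply: Ap; exists (1, q); first by [].
by rewrite /rat_line /= rmorph1; lra.
Qed.

(** The boundary of a rational diamond lies on lines of [B], so on [A] the
    diamond has the same trace as its closed version. *)
Lemma has_clopen_basis_A (R : realType) : has_clopen_basis (set_A R).
Proof.
have bD := basis_subspace (set_A R) _ (basis_diamond R).
eexists; first exact: bD.
move=> D BD; split; first exact: bD.1.
move: BD => -[_ [[[a b] [c d]] _ <-] <-{D}] /=.
have -> : (@set_val _ (set_A R)) @^-1` diamond R a b c d =
    set_val @^-1` closed_diamond R a b c d.
  apply/seteqP; split=> x; have Ax := set_valP x;
    rewrite /diamond /closed_diamond /= !in_itv/=.
    by move=> -[/andP[/ltW -> /ltW ->] /andP[/ltW -> /ltW ->]].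
  rewrite !le_eqVlt !(eq_sym (ratr _) _) !(negbTE (A_sum_neq_rat _ _ _ Ax)).
  by rewrite !(negbTE (A_diff_neq_rat _ _ _ Ax)).
apply: closed_comp (closed_closed_diamond R a b c d) => x _.
exact: initial_continuous.
Qed.

(** * The complement is not rr-good *)

Lemma dense_A_both_sides (R : realType) (p : R * R) (O : set (R * R)) :
  open O -> O p ->
  (exists2 q, (O `&` set_A R) q & q.1 < p.1) /\
  (exists2 q, (O `&` set_A R) q & p.1 < q.1).
Proof.
move=> oO Op.
have [e e0 boxO] := nbhs_box p O (open_nbhs_nbhs (conj oO Op)).
have side (I : set R) x : open I -> `|p.1 - x| < e -> I x ->
    exists2 q, (O `&` set_A R) q & I q.1.
  move=> oI px Ix.
  have [] : O `&` [set q | I q.1] `&` set_A R !=set0.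
    apply: dense_A.
      by exists (x, p.2); split=> //; apply: boxO; rewrite // subrr normr0.
    apply: openI => //; apply: open_comp oI => q _; exact: cvg_fst.
  by move=> q [[Oq Iq] Aq]; exists q.
split.
  apply: (side [set x | x < p.1] (p.1 - e / 2)) => /=; last lra.
    exact: open_lt.
  by rewrite opprB addrC subrK gtr0_norm; lra.
apply: (side [set x | p.1 < x] (p.1 + e / 2)) => /=; last lra.
  exact: open_gt.
by rewrite opprD addrA subrr sub0r normrN gtr0_norm; lra.
Qed.

(** The test function is [`|x - x_p| - (x - x_p)], twice the negative part of
    [x - x_p]: its zero set is the trace on [A] of the closed half-plane to the
    right of [p]. *)
Lemma not_rr_good_A (R : realType) : ~ rr_good R (set_A R).
Proof.
move=> good.
have [|p0 [_ Ap0]] := dense_A R setT _ openT; first by exists (0, 0).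
pose p : set_A R := SigSub (mem_set Ap0).
pose fst (q : set_A R) : R := (set_val q).1.
have cfst : continuous fst.
  move=> q; apply: continuous_comp; last exact: cvg_fst.
  exact: initial_continuous.
pose g q := `|fst q - fst p| - (fst q - fst p).
have cg : continuous g.
  suff cont (X : topologicalType) (f : X -> R) (c : R) :
      continuous f -> continuous (fun x => `|f x - c| - (f x - c)).
    exact: cont.
  move=> cf; have cd : continuous (fun x => f x - c).
    by move=> x; apply: cvgB; [exact: cf|exact: cvg_cst].
  by move=> x; exact: (cvgB (cvg_norm (cd x)) (cd x)).
have Z := rr_good_closed_interior_zero _ _ g (has_clopen_basis_A R) good cg.
have right_Z q : fst p < fst q -> (interior [set q | g q = 0]) q.
  move=> pq.
  have oR : open [set q | fst p < fst q].
    apply: (@open_comp _ _ fst [set x | fst p < x]) => [z _|].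
      exact: cfst.
    exact: open_gt.
  apply: filterS (open_nbhs_nbhs (conj oR pq)) => z /= pz.
  by rewrite /g gtr0_norm ?subr_gt0// subrr.
have : interior [set q | g q = 0] p.
  apply: Z => N; rewrite nbhsE => -[_ [ [V oV <-] Vp] VN].
  have [_ [q [Vq Aq] pq]] := dense_A_both_sides R _ _ oV Vp.
  pose q' : set_A R := SigSub (mem_set Aq).
  by exists q'; split; [exact: right_Z|exact: VN].
rewrite /interior nbhsE => -[_ [ [V oV <-] Vp] VZ].
have [[q [Vq Aq] qp] _] := dense_A_both_sides R _ _ oV Vp.
have /VZ : (set_val @^-1` V) (SigSub (mem_set Aq) : set_A R) by [].
rewrite /g /fst /= ltr0_norm ?subr_lt0//.
by move: qp => /=; lra.
Qed.

Theorem theorem3p4 (R : realType) :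
  [/\ dense (set_B R), locally_connected (set_B R) & rr_good R (set_B R)] /\
  [/\ dense (set_A R), has_clopen_basis (set_A R) & ~ rr_good R (set_A R)].
Proof.
have lcB := locally_connected_B R.
split; split=> //.
- exact: dense_B.
- exact: locally_connected_rr_good.
- exact: dense_A.
- exact: has_clopen_basis_A.
- exact: not_rr_good_A.
Qed.
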